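(* Let $d\in\mathbb{N}$ and let $I$ be an index set. There is an isomorphism between $(\mathcal F_{0,d}[I],\subseteq,\mathfrak m)$ and $(\hat{\mathcal F}_{0,d}[I],\hat\subseteq,\hat{\mathfrak m})$, that is, a bijection $\mathcal F_{0,d}[I]\to\hat{\mathcal F}_{0,d}[I]$ which is an isomorphism of posets and which intertwines $\mathfrak m$ and $\hat{\mathfrak m}$.
   Context: Directed forests. A directed forest $(\mathcal N,\mathcal E)$ consists of a finite set of nodes $\mathcal N$ (taken from some fixed infinite set) and edges $\mathcal E\subseteq \mathcal N\times\mathcal N$, such that the graph is acyclic and each connected component is a tree whose edges all point towards a single node, its root; so each non-root node $x$ has exactly one $y$ (its parent) with $(x,y)\in\mathcal E$, and a root has none. $\mathfrak r(\mathcal N)$ is the set of roots. The depth of a node is the number of edges of its path to its root. Write $x\le y$ if depth$(x)\le$ depth$(y)$, $x<y$ if depth$(x)<$ depth$(y)$, and $x\lesseqqgtr y$ if the depths are equal. Tagged partitions. For a finite set $M$ and an index set $J$, $\mathcal P(M)[J]$ is the set of pairs $(p_J,P)$ with $p_J=(p_\iota)_{\iota\in J}$ a family of mutually disjoint (possibly empty) subsets of $M$ and $P$ a partition of $M\setminus\bigcup_{\iota\in J} p_\iota$ into non-empty blocks. $(p_J,P)\subseteq(q_J,Q)$ means: $p_\iota\subseteq q_\iota$ for all $\iota\in J$, and for every $p\in P$ there is $q\in Q\cup\{q_\iota:\iota\in J\}$ with $p\subseteq q$. Set $\mathfrak m[(p_J,P)]=|P|$. We write $[0]$ for $[\{0\}]$.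 Lions forests. $\mathcal F_{0,d}[I]$ is the set of tuples $T=(\mathcal N,\mathcal E,h_I,H,\mathcal L)$ where $(\mathcal N,\mathcal E)$ is a directed forest (possibly empty), $\mathcal L:\mathcal N\to\{1,\dots,d\}$, and $(h_I,H)\in\mathcal P(\mathcal N)[I]$ is such that, with $H'=(H\cup\{h_\iota:\iota\in I\})\setminus\{\emptyset\}$: (1) if $h\in H'$, $x,y\in h$ and $x<y$, then there is $z\in h$ with $(y,z)\in\mathcal E$; (2) if $h\in H'$, $x_1,y_1\in h$, $x_1\lesseqqgtr y_1$, $(x_1,x_2),(y_1,y_2)\in\mathcal E$ and $x_2\ne y_2$, then $x_2,y_2\in h$; (3) for each $\iota\in I$, if $h_\iota\neq\emptyset$ then $h_\iota$ contains a root. The order is: $(\mathcal N,\mathcal E,h_I,H,\mathcal L)\subseteq(\mathcal N',\mathcal E',h'_I,H',\mathcal L')$ iff $(\mathcal N,\mathcal E,\mathcal L)=(\mathcal N',\mathcal E',\mathcal L')$ and $(h_I,H)\subseteq(h_I',H')$. Set $\mathfrak m[T]=|H|$. Lions partition forests. For $x\in\mathcal N$ put $\mathcal N_x=\{y\in\mathcal N:(y,x)\in\mathcal E\}$. $\hat{\mathcal F}_{0,d}[I]$ is the set of tuples $(\mathcal N,\mathcal E,(\hat h_I,\hat H),\mathfrak H,\mathcal L)$ where $(\mathcal N,\mathcal E)$ is a (possibly empty) directed forest, $\mathcal L:\mathcal N\to\{1,\dots,d\}$, $(\hat h_I,\hat H)\in\mathcal P(\mathfrak r(\mathcal N))[I]$,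 and $\mathfrak H$ assigns to each $x\in\mathcal N$ an element $\mathfrak H[x]\in\mathcal P(\mathcal N_x)[0]$. The order $\hat\subseteq$ is: equal $(\mathcal N,\mathcal E,\mathcal L)$, $(\hat h_I,\hat H)\subseteq(\hat h'_I,\hat H')$, and $\mathfrak H[x]\subseteq\mathfrak H'[x]$ for all $x\in\mathcal N$. Finally $\hat{\mathfrak m}=|\hat H|+\sum_{x\in\mathcal N}\mathfrak m[\mathfrak H[x]]$. *)

(* Defs.v *)
From mathcomp Require Import boolp classical_sets cardinality.
From mathcomp Require Import all_boot finmap.

Set Implicit Arguments.
Unset Strict Implicit.
Unset Printing Implicit Defensive.

Section TaggedPartitions.
Variables (T : finType) (J : Type).

(* The pairs (p_J, P) of P(M)[J], for M a subset of the finite type T. The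
   index set J may be infinite, hence the propositional union of the tags. *)
Record tpartition (M : {set T}) := TPartition {
  tp_tag : J -> {set T};
  tp_blocks : {set {set T}};
  tp_tag_sub : forall j, tp_tag j \subset M;
  tp_tag_disjoint : forall i j, i <> j -> [disjoint tp_tag i & tp_tag j];
  tp_blocks_partition :
    partition tp_blocks (M :\: [set x | `[< exists j, x \in tp_tag j >]])
}.

(* c belongs to P or is one of the tagged sets (which may be empty). *)
Definition tp_class M (p : tpartition M) (c : {set T}) : Prop :=
  c \in tp_blocks p \/ exists j, c = tp_tag p j.

Definition tp_le M (p q : tpartition M) : Prop :=
  (forall j, tp_tag p j \subset tp_tag q j) /\
  (forall b, b \in tp_blocks p -> exists2 c, tp_class q c & b \subset c).

Definition tp_m M (p : tpartition M) : nat := #|tp_blocks p|.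

End TaggedPartitions.

Section DirectedGraphs.
Variables (T : finType) (E : {set T * T}).

Definition darc : rel T := fun x y => (x, y) \in E.

Definition adj : rel T := fun x y => darc x y || darc y x.

(* No directed cycle; loops and 2-cycles, which are invisible in adj, are
   excluded here. *)
Definition dacyclic : Prop := forall c : seq T, cycle darc c -> c = [::].

Definition is_tree (C : {pred T}) : Prop :=
  {in C &, forall x y,
    exists! p : seq T, [/\ path adj x p, last x p = y & uniq (x :: p)]}.

(* Every edge of C points towards r: it is the first edge of a directed path
   ending in r. *)
Definition points_towards (C : {pred T}) (r : T) : Prop :=
  {in C &, forall x y, darc x y -> connect darc y r}.

Definition is_dforest : Prop :=
  dacyclic /\
  forall x, let C := connect adj x in
    is_tree C /\ exists2 r, r \in C & points_towards C r.

Definition roots : {set T} := [set x | [forall y, (x, y) \notin E]].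

Definition children (x : T) : {set T} := [set y | (y, x) \in E].

Lemma dforest_path_to_root : is_dforest -> forall x,
  exists p : seq T, path darc x p && (last x p \in roots).
Proof.
move=> [acE compE] x; have [_ [r Cr toE]] := compE x.
have r_root : r \in roots.
  rewrite inE; apply/forallP => y; apply/negP => ry.
  have Cy : y \in connect adj x.
    by apply: connect_trans Cr _; apply: connect1; rewrite /adj /darc ry.
  have /connectP[p yp def_r] := toE r y Cr Cy ry.
  suff /acE : cycle darc (y :: p) by [].
  by rewrite /= rcons_path yp -def_r.
suff /connectP[p xp def_r] : connect darc x r by exists p; rewrite xp -def_r.
have /connectP[[|a p] /=] := Cr; first by move=> _ ->.
case/andP=> xa _ _.
have Cx : x \in connect adj x by apply: connect0.
have Ca : a \in connect adj x by apply: connect1.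
case/orP: xa => [xa|ax]; last exact: toE ax.
exact: connect_trans (connect1 xa) (toE x a Cx Ca xa).
Qed.

(* The number of edges of the (unique) path from x to its root. *)
Definition depth (EF : is_dforest) (x : T) : nat :=
  size (xchoose (dforest_path_to_root EF x)).

End DirectedGraphs.

(* Labelled directed forests (N, E, L), with nodes in the ambient set V; the
   d labels are indexed from 0. *)
Record lforest (V : choiceType) (d : nat) := LForest {
  nodes : {fset V};
  edges : {set nodes * nodes};
  labels : {ffun nodes -> 'I_d};
  edgesP : is_dforest edges
}.

Section LionsForests.
Variables (V : choiceType) (d : nat) (I : Type).

Definition fdepth (F : lforest V d) : nodes F -> nat := depth (edgesP F).

Section Conditions.
Variables (F : lforest V d) (p : tpartition I [set: nodes F]).

Definition lions_class (h : {set nodes F}) : Prop :=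
  tp_class p h /\ h != set0.

Definition lions_cond1 : Prop :=
  forall h x y, lions_class h -> x \in h -> y \in h ->
    fdepth x < fdepth y ->
    exists2 z, z \in h & (y, z) \in edges F.

Definition lions_cond2 : Prop :=
  forall h x1 y1 x2 y2, lions_class h -> x1 \in h -> y1 \in h ->
    fdepth x1 = fdepth y1 ->
    (x1, x2) \in edges F -> (y1, y2) \in edges F -> x2 <> y2 ->
    x2 \in h /\ y2 \in h.

Definition lions_cond3 : Prop :=
  forall i, tp_tag p i != set0 ->
    exists2 r, r \in tp_tag p i & r \in roots (edges F).

End Conditions.

Record lions_data (F : lforest V d) := LionsData {
  lions_part : tpartition I [set: nodes F];
  lions_cond1P : lions_cond1 lions_part;
  lions_cond2P : lions_cond2 lions_part;
  lions_cond3P : lions_cond3 lions_part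
}.

Record lions_forest := LionsForest {
  lf_forest : lforest V d;
  lf_data : lions_data lf_forest
}.

(* The constructor forces both sides to have the same (N, E, L). *)
Inductive lf_le : lions_forest -> lions_forest -> Prop :=
  LfLe (F : lforest V d) (A B : lions_data F) of
    tp_le (lions_part A) (lions_part B) :
    lf_le (LionsForest A) (LionsForest B).

Definition lf_m (A : lions_forest) : nat := tp_m (lions_part (lf_data A)).

(* The one-element type unit plays the role of the index set {0}. *)
Record lions_pdata (F : lforest V d) := LionsPData {
  root_part : tpartition I (roots (edges F));
  child_part : forall x : nodes F, tpartition unit (children (edges F) x)
}.

Record lions_pforest := LionsPForest {
  lpf_forest : lforest V d;
  lpf_data : lions_pdata lpf_forest
}.

Inductive lpf_le : lions_pforest -> lions_pforest -> Prop :=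
  LpfLe (F : lforest V d) (A B : lions_pdata F) of
    tp_le (root_part A) (root_part B) &
    (forall x, tp_le (child_part A x) (child_part B x)) :
    lpf_le (LionsPForest A) (LionsPForest B).

Definition lpf_m (A : lions_pforest) : nat :=
  tp_m (root_part (lpf_data A)) +
  \sum_(x : nodes (lpf_forest A)) tp_m (child_part (lpf_data A) x).

End LionsForests.

(* Main.v *)
Require Import Defs.
From mathcomp Require Import boolp classical_sets cardinality.
From mathcomp Require Import all_boot finmap.

Set Implicit Arguments.
Unset Strict Implicit.
Unset Printing Implicit Defensive.

(** The two structures carry the same information because, in a Lions forest,
    a node in the same class as a strictly higher node, or as a node of its
    own depth with another parent, is in the class of its own parent. So a
    nonempty class h is made of top nodes, which are all roots or all children
    of one node outside h, and of nodes whose parent lies in h. Recording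
    how h meets the roots, and how it meets the children of each node x (the
    children in the class of x being tagged by 0), loses nothing.

    In the direction from Lions forests to Lions partition forests
    ([restrict]), the root partition consists of the traces of all classes on
    the roots; the partition of the children of x has as tagged set the
    children related to x, and as blocks the traces of the untagged classes
    that do not contain x. Both orders compare the relation of being in a
    common class together with the tags ([tp_leP]), and two related nodes can
    be compared by induction on their depths, replacing nodes by their
    parents; so [restrict] preserves and reflects the order ([restrict_le],
    [restrict_le_inv]), and is injective by antisymmetry.

    Each untagged class h has exactly one place where its top nodes sit, the
    roots or the children of some x ([starts_at_uniq]), and it contributes
    exactly one block, at that place; summing over all places gives the
    equality of the numbers of blocks ([restrict_card]).

    Conversely ([glue]), given a Lions partition forest, send a node y to
    [head y], reached by climbing from a node to its parent as long as the
    node is in the tagged set of the children of its parent. Every head lies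
    in a unique tagged set or block of roots, or block of children, and the
    classes of the glued Lions forest are the preimages of these sets under
    [head]. Restricting gives back the initial data ([glueK]). *)

(* The nodes without parent, rather than the homonymous component roots of
   finite graphs. *)
Local Notation roots := Defs.roots.

(** * Tagged partitions *)

Lemma partition_intro (T : finType) (P : {set {set T}}) (D : {set T}) :
    set0 \notin P ->
    (forall b c x, b \in P -> c \in P -> x \in b -> x \in c -> b = c) ->
    (forall x, x \in D <-> exists2 b, b \in P & x \in b) ->
  partition P D.
Proof.
move=> P0 Pdisj Pcover; apply/and3P; split=> //.
  apply/eqP/setP=> x; apply/bigcupP/idP => [[b Pb bx]|/Pcover[b Pb bx]].
    by apply/Pcover; exists b.
  by exists b.
apply/trivIsetP=> b c Pb Pc; apply: contraNT => /pred0Pn[x /andP[bx cx]].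
by apply/eqP; apply: Pdisj Pb Pc bx cx.
Qed.

Section TaggedPartitionTheory.
Variables (T : finType) (J : Type) (M : {set T}).
Implicit Types (p q : tpartition J M) (b c : {set T}) (x y z : T).

(** Two elements are related when they lie in a common class, be it a block
    or a tagged set. *)
Definition tp_rel p x y : Prop := exists c, [/\ tp_class p c, x \in c & y \in c].

Lemma tp_block_neq0 p b : b \in tp_blocks p -> exists x, x \in b.
Proof.
move=> pb; apply/set0Pn; apply: contraTneq pb => ->.
by case/and3P: (tp_blocks_partition p).
Qed.

Lemma tp_block_mem p b x : b \in tp_blocks p -> x \in b ->
  x \in M /\ forall j, x \notin tp_tag p j.
Proof.
move=> pb bx; have /and3P[/eqP covp _ _] := tp_blocks_partition p.
have: x \in cover (tp_blocks p) by apply/bigcupP; exists b.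
rewrite covp !inE => /andP[/asboolP ntag ->]; split=> // j.
by apply/negP => xj; apply: ntag; exists j.
Qed.

Lemma tp_class_sub p c x : tp_class p c -> x \in c -> x \in M.
Proof.
case=> [pb /(tp_block_mem pb)[]//|[j ->]].
exact: (fintype.subsetP (tp_tag_sub p j)).
Qed.

Lemma tp_class_ex p x : x \in M -> exists2 c, tp_class p c & x \in c.
Proof.
move=> Mx; have [[j xj]|ntag] := pselect (exists j, x \in tp_tag p j).
  by exists (tp_tag p j) => //; right; exists j.
have /and3P[/eqP covp _ _] := tp_blocks_partition p.
have: x \in cover (tp_blocks p).
  by rewrite covp !inE Mx andbT; apply/asboolP.
by case/bigcupP=> b pb bx; exists b => //; left.
Qed.

Lemma tp_tag_inj p i j x : x \in tp_tag p i -> x \in tp_tag p j -> i = j.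
Proof.
move=> xi xj; apply: contrapT => /(tp_tag_disjoint p) /pred0P /(_ x) /=.
by rewrite xi xj.
Qed.

Lemma tp_class_eq p c c' x :
  tp_class p c -> tp_class p c' -> x \in c -> x \in c' -> c = c'.
Proof.
case=> [pc|[i ->]] [pc'|[j ->]] xc xc'.
- have /and3P[_ tI _] := tp_blocks_partition p.
  by rewrite -(def_pblock tI pc xc) -(def_pblock tI pc' xc').
- by have [_ /(_ j)/negP] := tp_block_mem pc xc.
- by have [_ /(_ i)/negP] := tp_block_mem pc' xc'.
- by rewrite (tp_tag_inj xc xc').
Qed.

Lemma tp_rel_mem p c x y : tp_class p c -> x \in c -> tp_rel p x y -> y \in c.
Proof.
by move=> pc cx [c' [pc' c'x c'y]]; rewrite (tp_class_eq pc pc' cx c'x).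
Qed.

Lemma tp_rel_tag p j x y : x \in tp_tag p j -> tp_rel p x y -> y \in tp_tag p j.
Proof. by apply: tp_rel_mem; right; exists j. Qed.

Lemma tp_rel_sym p x y : tp_rel p x y -> tp_rel p y x.
Proof. by case=> c [pc cx cy]; exists c. Qed.

Lemma tp_rel_trans p x y z : tp_rel p x y -> tp_rel p y z -> tp_rel p x z.
Proof.
by case=> c [pc cx cy] yz; exists c; split=> //; apply: tp_rel_mem yz.
Qed.

Lemma tp_rel_dom p x y : tp_rel p x y -> x \in M /\ y \in M.
Proof. by case=> c [pc /(tp_class_sub pc) + /(tp_class_sub pc)]. Qed.

(** The order only depends on the tags and on the relation: a block is
    nonempty, so it is contained in the class of any of its elements. *)
Lemma tp_leP p q :
  tp_le p q <->
    (forall j, tp_tag p j \subset tp_tag q j) /\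
    (forall x y, tp_rel p x y -> tp_rel q x y).
Proof.
split=> -[tag_pq]; last first.
  move=> rel_pq; split=> // b pb; have [x bx] := tp_block_neq0 pb.
  have relb y : y \in b -> tp_rel q x y.
    by move=> yb; apply: rel_pq; exists b; split=> //; left.
  have [c [qc cx _]] := relb x bx; exists c => //.
  by apply/fintype.subsetP => y /relb; apply: tp_rel_mem.
move=> block_pq; split=> // x y [c [[pc|[j ->]] cx cy]].
  have [c' qc' /fintype.subsetP cc'] := block_pq c pc.
  by exists c'; split=> //; apply: cc'.
exists (tp_tag q j); split; first by right; exists j.
  exact: (fintype.subsetP (tag_pq j)).
exact: (fintype.subsetP (tag_pq j)).
Qed.

Lemma tp_le_refl p : tp_le p p.
Proof. by apply/tp_leP; split. Qed.

Lemma tp_le_anti p q : tp_le p q -> tp_le q p -> p = q.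
Proof.
move=> le_pq le_qp.
have tagE : tp_tag p = tp_tag q.
  apply/funext => j; apply/eqP.
  by rewrite eqEsubset; case: le_pq => -> _; case: le_qp => ->.
have sub_blocks p' q' : tp_tag p' = tp_tag q' -> tp_le p' q' -> tp_le q' p' ->
    tp_blocks p' \subset tp_blocks q'.
  move=> tagE' [_ le1] [_ le2]; apply/fintype.subsetP => b pb.
  have [x bx] := tp_block_neq0 pb.
  have [c [qc|[j ->]] /fintype.subsetP bc] := le1 b pb; last first.
    have [_ /(_ j)/negP[]] := tp_block_mem pb bx.
    by rewrite tagE'; apply: bc.
  have [c' pc' /fintype.subsetP cc'] := le2 c qc.
  have E : b = c' by apply: (tp_class_eq _ pc' bx (cc' x (bc x bx))); left.
  suff -> : b = c by [].
  apply/eqP; rewrite eqEsubset; apply/andP; split; apply/fintype.subsetP => //.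
  by rewrite E.
have blocksE : tp_blocks p = tp_blocks q.
  by apply/eqP; rewrite eqEsubset !sub_blocks.
case: p q tagE blocksE {le_pq le_qp} => [t P s1 d1 p1] [t' P' s2 d2 p2] /= E1 E2.
by subst t' P'; congr TPartition; apply: Prop_irrelevance.
Qed.

Lemma tp_eq p q :
    (forall j x, x \in tp_tag p j <-> x \in tp_tag q j) ->
    (forall x y, tp_rel p x y <-> tp_rel q x y) ->
  p = q.
Proof.
move=> tagE relE; apply: tp_le_anti; apply/tp_leP.
  by split=> [j|x y /relE//]; apply/fintype.subsetP => x /tagE.
by split=> [j|x y /relE//]; apply/fintype.subsetP => x /tagE.
Qed.

End TaggedPartitionTheory.

(** * Directed forests *)

Section DirectedForestTheory.
Variables (T : finType) (E : {set T * T}) (EF : is_dforest E).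
Implicit Types (x y z : T).

Lemma arc_not_back x y : (x, y) \in E -> ~ connect (darc E) y x.
Proof.
move=> xy /connectP[p yp def_x]; have [acE _] := EF.
suff /acE : cycle (darc E) (y :: p) by [].
by rewrite /= rcons_path yp -def_x.
Qed.

(** Two different parents would give two simple undirected paths from x to
    the node towards which its component points. *)
Lemma parent_uniq x y z : (x, y) \in E -> (x, z) \in E -> y = z.
Proof.
move=> xy xz; have [_ /(_ x)[treeC [r Cr toE]]] := EF.
have Cx : x \in connect (adj E) x by apply: connect0.
have simple_path w : (x, w) \in E ->
    exists p, [/\ path (adj E) x (w :: p), last x (w :: p) = r & uniq (x :: w :: p)].
  move=> xw; have Cw : w \in connect (adj E) x.
    by apply: connect1; rewrite /adj /darc xw.
  have /connectP[p0 wp0 ->] := toE x w Cx Cw xw.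
  case: (shortenP wp0) => p wp Up _; exists p; split=> //.
    rewrite /= /adj {1}/darc xw /=; apply: sub_path wp => a b ab.
    by rewrite ab.
  rewrite cons_uniq Up andbT; apply/negP => xp.
  apply: (arc_not_back xw); case/splitPl: xp wp => p1 p2 <-.
  by rewrite cat_path => /andP[wp1 _]; apply/connectP; exists p1.
have [p [xp lp Up]] := simple_path y xy.
have [q [xq lq Uq]] := simple_path z xz.
have [s [_ s_uniq]] := treeC x r Cx Cr.
have def_s : s = y :: p by apply: s_uniq.
by have : s = z :: q by [apply: s_uniq]; rewrite def_s => -[].
Qed.

Lemma rootP x : reflect (forall y, (x, y) \notin E) (x \in roots E).
Proof. by rewrite inE; apply: forallP. Qed.

Lemma root_or_child x : x \in roots E \/ exists y, (x, y) \in E.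
Proof.
have [|] := boolP (x \in roots E); first by left.
by rewrite inE negb_forall => /existsP[y]; rewrite negbK; right; exists y.
Qed.

Lemma root_path_uniq x p q :
    path (darc E) x p -> last x p \in roots E ->
    path (darc E) x q -> last x q \in roots E -> p = q.
Proof.
elim: p x q => [|y p IHp] x [|z q] //=.
- by move=> _ /rootP xr /andP[/(negP (xr z))].
- by move=> /andP[+ _] _ _ /rootP xr => /(negP (xr y)).
move=> /andP[xy yp] lp /andP[xz zq] lq.
rewrite -(parent_uniq xy xz) in zq lq *.
by rewrite (IHp y q).
Qed.

Lemma depth_path x p :
  path (darc E) x p -> last x p \in roots E -> depth EF x = size p.
Proof.
move=> xp lp; rewrite /depth.
have /andP[xq lq] := xchooseP (dforest_path_to_root EF x).
by rewrite (root_path_uniq xq lq xp lp).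
Qed.

Lemma depth_root x : x \in roots E -> depth EF x = 0.
Proof. by move=> xr; rewrite (@depth_path x [::]). Qed.

Lemma depth_arc x y : (x, y) \in E -> depth EF x = (depth EF y).+1.
Proof.
move=> xy; have [p /andP[yp lp]] := dforest_path_to_root EF y.
by rewrite (depth_path yp lp) (@depth_path x (y :: p)) //= /darc xy.
Qed.

End DirectedForestTheory.

(** * Traces of a family of disjoint sets *)

Lemma sum_option (T : finType) (F : option T -> nat) :
  \sum_o F o = F None + \sum_x F (Some x).
Proof.
rewrite (bigD1 None) //= (reindex_omap Some id) => [|[x|] //].
by congr (_ + _); apply: eq_bigl => x; rewrite /= eqxx.
Qed.

Section Trace.
Variables (T : finType).
Implicit Types (P : {set {set T}}) (S D b h : {set T}).

(** The nonempty intersections of the members of P with S. *)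
Definition trace P S : {set {set T}} := [set h :&: S | h in P] :\ set0.

Lemma traceP P S b :
  reflect (b != set0 /\ exists2 h, h \in P & b = h :&: S) (b \in trace P S).
Proof. by rewrite in_setD1; apply: (iffP andP) => -[-> /imsetP]. Qed.

Lemma mem_trace P S h x : h \in P -> x \in h -> x \in S -> h :&: S \in trace P S.
Proof.
move=> Ph hx Sx; apply/traceP; split; last by exists h.
by apply/set0Pn; exists x; rewrite inE hx.
Qed.

Lemma trivIset_eq P h h' x :
  trivIset P -> h \in P -> h' \in P -> x \in h -> x \in h' -> h = h'.
Proof. by move=> tI Ph Ph' hx /(def_pblock tI Ph'); rewrite (def_pblock tI Ph hx). Qed.

Lemma trace_partition P S D :
    trivIset P ->
    (forall x, x \in D <-> x \in S /\ exists2 h, h \in P & x \in h) ->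
  partition (trace P S) D.
Proof.
move=> tI defD; apply: partition_intro; first by rewrite !inE eqxx.
  move=> b c x /traceP[_ [h Ph ->]] /traceP[_ [h' Ph' ->]].
  rewrite !inE => /andP[hx _] /andP[h'x _].
  by rewrite (trivIset_eq tI Ph Ph' hx h'x).
move=> x; split=> [/defD[Sx [h Ph hx]]|[b /traceP[_ [h Ph ->]]]].
  by exists (h :&: S); [apply: mem_trace hx Sx | rewrite inE hx].
by rewrite inE => /andP[hx Sx]; apply/defD; split=> //; exists h.
Qed.

Lemma card_trace P S : trivIset P ->
  #|trace P S| = #|[set h in P | h :&: S != set0]|.
Proof.
move=> tI.
have -> : trace P S = [set h :&: S | h in [set h in P | h :&: S != set0]].
  apply/setP => b; apply/traceP/imsetP => [[b0 [h Ph def_b]]|[h]].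
    by exists h; rewrite // inE Ph -def_b.
  by rewrite inE => /andP[Ph hS0 ->]; split=> //; exists h.
apply: card_in_imset => h h'.
rewrite !inE => /andP[Ph /set0Pn[x Sx]] /andP[Ph' _] eq_hS.
have := Sx; rewrite eq_hS; move: Sx; rewrite !inE => /andP[hx _] /andP[h'x _].
exact: (trivIset_eq tI Ph Ph' hx h'x).
Qed.

End Trace.

(** * From Lions forests to Lions partition forests *)

Section Restriction.
Variables (V : choiceType) (d : nat) (I : Type) (F : lforest V d).
Variable (A : lions_data I F).
Local Notation E := (edges F).
Local Notation p := (lions_part A).
Implicit Types (x y z : nodes F).

Lemma lions_parent_deeper x y y' :
  tp_rel p x y -> fdepth x < fdepth y -> (y, y') \in E -> tp_rel p y y'.
Proof.
move=> [c [pc cx cy]] lt_xy yy'.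
have lc : lions_class p c by split=> //; apply/set0Pn; exists x.
have [z cz yz] := lions_cond1P lc cx cy lt_xy.
by exists c; split=> //; rewrite (parent_uniq (edgesP F) yy' yz).
Qed.

Lemma lions_parent_level x y x' y' :
    tp_rel p x y -> fdepth x = fdepth y ->
    (x, x') \in E -> (y, y') \in E -> x' <> y' ->
  tp_rel p x x' /\ tp_rel p y y'.
Proof.
move=> [c [pc cx cy]] eq_xy xx' yy' neq_x'y'.
have lc : lions_class p c by split=> //; apply/set0Pn; exists x.
have [cx' cy'] := lions_cond2P lc cx cy eq_xy xx' yy' neq_x'y'.
by split; exists c.
Qed.

(** A tagged set contains a root, which is higher than any non-root node of
    the tagged set; hence the parent of such a node is tagged as well. *)
Lemma lions_tag_parent i x x' :
  x \in tp_tag p i -> (x, x') \in E -> tp_rel p x x'.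
Proof.
move=> tx xx'; have [|r tr rr] := @lions_cond3P _ _ _ _ A i.
  by apply/set0Pn; exists x.
apply: (@lions_parent_deeper r) => //.
  by exists (tp_tag p i); split=> //; right; exists i.
by rewrite /fdepth (depth_root _ rr) (depth_arc _ xx').
Qed.

Lemma lions_block_ex x : (forall i, x \notin tp_tag p i) ->
  exists2 h, h \in tp_blocks p & x \in h.
Proof.
move=> ntag; have [|c [pc|[i ->]] cx] := @tp_class_ex _ _ _ p x.
- by rewrite inE.
- by exists c.
by have /negP := ntag i.
Qed.

Lemma lions_trivIset : trivIset (tp_blocks p).
Proof. by case/and3P: (tp_blocks_partition p). Qed.

Definition root_tag i := tp_tag p i :&: roots E.

Lemma root_tag_sub i : root_tag i \subset roots E.
Proof. exact: subsetIr. Qed.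

Lemma root_tag_disjoint i j : i <> j -> [disjoint root_tag i & root_tag j].
Proof.
move=> /(tp_tag_disjoint p); apply: disjointW; exact: subsetIl.
Qed.

Lemma root_trace_partition :
  partition (trace (tp_blocks p) (roots E))
            (roots E :\: [set x | `[< exists i, x \in root_tag i >]]).
Proof.
apply: trace_partition lions_trivIset _ => x.
rewrite in_setD in_set; split=> [/andP[/asboolP ntag rx]|[rx [h ph hx]]].
  split=> //; apply: lions_block_ex => i; apply/negP => xi.
  by apply: ntag; exists i; rewrite in_setI xi.
rewrite rx andbT; apply/asboolP => -[i]; rewrite in_setI => /andP[xi _].
by have [_ /(_ i)/negP] := tp_block_mem ph hx.
Qed.

(** The partition of the roots induced by the classes of the Lions forest. *)
Definition restrict_roots : tpartition I (roots E) :=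
  TPartition root_tag_sub root_tag_disjoint root_trace_partition.

(** The children of x that lie in the class of x. *)
Definition child_tag x (_ : unit) := [set y in children E x | `[< tp_rel p y x >]].

Lemma child_tag_sub x u : child_tag x u \subset children E x.
Proof. by apply/fintype.subsetP => y; rewrite in_set => /andP[]. Qed.

Lemma child_tag_disjoint x (u v : unit) :
  u <> v -> [disjoint child_tag x u & child_tag x v].
Proof. by case: u v => -[]. Qed.

(** The blocks not containing x: the class of x, when it is a block, gives the
    tagged set of the children of x rather than a block. *)
Definition blocks_off x := [set h in tp_blocks p | x \notin h].

Lemma blocks_off_trivIset x : trivIset (blocks_off x).
Proof.
apply: trivIsetS lions_trivIset.
by apply/fintype.subsetP => h; rewrite in_set => /andP[].
Qed.

Lemma child_trace_partition x :
  partition (trace (blocks_off x) (children E x))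
            (children E x :\: [set y | `[< exists u, y \in child_tag x u >]]).
Proof.
apply: trace_partition (blocks_off_trivIset x) _ => y.
rewrite in_setD in_set; split=> [/andP[/asboolP ntag cy]|[cy [h ph hy]]].
  have nrel : ~ tp_rel p y x.
    by move=> yx; apply: ntag; exists tt; rewrite in_set cy; apply/asboolP.
  split=> //; have yx : (y, x) \in E by move: cy; rewrite in_set.
  have [i|h ph hy] := @lions_block_ex y.
    by apply/negP => /lions_tag_parent/(_ yx).
  exists h => //; rewrite in_set ph; apply/negP => hx; apply: nrel.
  by exists h; split=> //; left.
rewrite cy andbT; apply/asboolP => -[u]; rewrite in_set => /andP[_ /asboolP yx].
move: ph; rewrite in_set => /andP[ph /negP]; apply.
by apply: tp_rel_mem hy yx; left.
Qed.

(** The partition of the children of x induced by the classes of the Lions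
    forest, with the class of x as the origin of the tagged set. *)
Definition restrict_children x : tpartition unit (children E x) :=
  TPartition (@child_tag_sub x) (@child_tag_disjoint x) (child_trace_partition x).

(** The Lions partition forest associated with a Lions forest. *)
Definition restrict : lions_pdata I F :=
  LionsPData restrict_roots restrict_children.

Lemma restrict_roots_rel x y :
  tp_rel restrict_roots x y <-> [/\ x \in roots E, y \in roots E & tp_rel p x y].
Proof.
split=> [xy|[rx ry [c [[pc|[i ->]] cx cy]]]].
- have [rx ry] := tp_rel_dom xy; split=> //.
  case: xy => c [[/traceP[_ [h ph ->]]|[i ->]]]; rewrite !in_setI.
    by move=> /andP[hx _] /andP[hy _]; exists h; split=> //; left.
  by move=> /andP[xi _] /andP[yi _]; exists (tp_tag p i); split=> //; right; exists i.
- exists (c :&: roots E); rewrite !in_setI cx cy rx ry; split=> //.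
  by left; apply: mem_trace cx rx.
exists (root_tag i); rewrite !in_setI cx cy rx ry; split=> //.
by right; exists i.
Qed.

(** Children of x in a common tagged set are related to x, by
    [lions_tag_parent], hence are in the tagged set of the children of x. *)
Lemma restrict_children_rel x y z :
  tp_rel (restrict_children x) y z <->
    [/\ (y, x) \in E, (z, x) \in E & tp_rel p y z].
Proof.
split=> [yz|[yx zx yz]].
  have [] := tp_rel_dom yz; rewrite !in_set => yx zx; split=> //.
  case: yz => c [[/traceP[_ [h ph ->]]|[u ->]]].
    rewrite !in_setI => /andP[hy _] /andP[hz _].
    by move: ph; rewrite in_set => /andP[ph _]; exists h; split=> //; left.
  rewrite !in_set => /andP[_ /asboolP rel_y] /andP[_ /asboolP rel_z].
  exact: tp_rel_trans rel_y (tp_rel_sym rel_z).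
have [rel_yx|nrel_yx] := pselect (tp_rel p y x).
  exists (child_tag x tt); split; first by right; exists tt.
    by rewrite !in_set yx; apply/asboolP.
  rewrite !in_set zx; apply/asboolP.
  exact: tp_rel_trans (tp_rel_sym yz) rel_yx.
case: yz => c [[pc|[i ->]] cy cz]; last by have := lions_tag_parent cy yx.
exists (c :&: children E x); rewrite !in_setI cy cz !in_set yx zx; split=> //.
left; apply: mem_trace (cy) _; last by rewrite in_set.
rewrite in_set pc; apply/negP => cx; apply: nrel_yx.
by exists c; split=> //; left.
Qed.

(** The place of the top nodes of h: for Some x, some node of h is a child of
    x while x is outside h; for None, some node of h is a root. *)
Definition starts_at (h : {set nodes F}) (o : option (nodes F)) : bool :=
  if o is Some x then (x \notin h) && (h :&: children E x != set0)
  else h :&: roots E != set0.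

(** The parent of x, or None when x is a root. *)
Definition parent_opt x : option (nodes F) := [pick y | (x, y) \in E].

Lemma parent_optP x o :
  parent_opt x = o <-> if o is Some y then (x, y) \in E else x \in roots E.
Proof.
rewrite /parent_opt; case: pickP => [y xy|noy].
  split=> [<- //|]; case: o => [z xz|/rootP/(_ y)/negP //].
  by rewrite (parent_uniq (edgesP F) xy xz).
split=> [<-|]; first by apply/rootP => y; rewrite noy.
by case: o => // y; rewrite noy.
Qed.

Lemma starts_atP (h : {set nodes F}) o :
  reflect (exists2 y, y \in h & parent_opt y = o /\ forall x, o = Some x -> x \notin h)
          (starts_at h o).
Proof.
case: o => [x|] /=; [apply: (iffP andP)|apply: (iffP (set0Pn _))].
- move=> [hx /set0Pn[y]]; rewrite !in_set => /andP[hy yx].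
  by exists y => //; split=> [|_ [<-] //]; apply/parent_optP.
- move=> [y hy [/parent_optP yx] /(_ x erefl) hx]; split=> //.
  by apply/set0Pn; exists y; rewrite in_setI hy in_set.
- move=> [y]; rewrite in_setI => /andP[hy ry].
  by exists y => //; split=> //; apply/parent_optP.
by move=> [y hy [/parent_optP ry _]]; exists y; rewrite in_setI hy.
Qed.

(** A node of minimal depth in h has its parent outside h, and conditions (1)
    and (2) force every other node with this property to be at the same depth
    and to have the same parent. *)
Lemma starts_at_uniq (h : {set nodes F}) :
  h \in tp_blocks p -> exists o, starts_at h =1 pred1 o.
Proof.
move=> ph; have [y0 hy0] := tp_block_neq0 ph.
have relh y z : y \in h -> z \in h -> tp_rel p y z.
  by move=> hy hz; exists h; split=> //; left.
have memh y z : y \in h -> tp_rel p y z -> z \in h.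
  by apply: tp_rel_mem; left.
have [y hy min_y] := arg_minnP (@fdepth V d F) hy0.
have top_y x : (y, x) \in E -> x \notin h.
  move=> yx; apply/negP => /min_y.
  by rewrite /fdepth (depth_arc _ yx) ltnn.
exists (parent_opt y) => o /=; apply/starts_atP/eqP => [[z hz [def_o top_z]]|->].
  have no_parent x : (z, x) \in E -> x \in h -> False.
    by move=> /(parent_optP z (Some x)) zx; apply/negP/top_z; rewrite -def_o.
  have eq_yz : fdepth z = fdepth y.
    apply/eqP; rewrite eqn_leq min_y // andbT leqNgt; apply/negP => lt_yz.
    have [rz|[x zx]] := root_or_child E z.
      by rewrite {2}/fdepth depth_root in lt_yz.
    have /memh hx := lions_parent_deeper (relh y z hy hz) lt_yz zx.
    exact: no_parent zx (hx hz).
  rewrite -def_o; apply/parent_optP.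
  case def_y: (parent_opt y) => [x|]; move/parent_optP: def_y.
    move=> yx; have [rz|[x' zx']] := root_or_child E z.
      by move: eq_yz; rewrite /fdepth (depth_root _ rz) (depth_arc _ yx).
    have [-> //|neq] := pselect (x = x').
    have [_ /memh] := lions_parent_level (relh y z hy hz) (esym eq_yz) yx zx' neq.
    by move=> /(_ hz) /(no_parent x' zx').
  move=> ry; have [//|[x' zx']] := root_or_child E z.
  by move: eq_yz; rewrite /fdepth (depth_root _ ry) (depth_arc _ zx').
by exists y => //; split=> // x /parent_optP; apply: top_y.
Qed.

(** Both sides count the pairs of a block h and a place o where h starts. *)
Lemma restrict_card :
  tp_m restrict_roots + \sum_x tp_m (restrict_children x) = tp_m p.
Proof.
have -> : tp_m p = \sum_(h in tp_blocks p) \sum_(o | starts_at h o) 1.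
  rewrite /tp_m -sum1_card; apply: eq_bigr => h /starts_at_uniq[o def_o].
  by rewrite (eq_bigl _ _ def_o) big_pred1_eq.
rewrite (exchange_big_dep predT) //= sum_option /tp_m /= card_trace ?lions_trivIset //.
rewrite sum1dep_card; congr (_ + _).
apply: eq_bigr => x _; rewrite card_trace ?blocks_off_trivIset // sum1dep_card.
by apply: eq_card => h; rewrite !in_set andbA.
Qed.

End Restriction.

(** * Comparison of the orders *)

Section RestrictionOrder.
Variables (V : choiceType) (d : nat) (I : Type) (F : lforest V d).
Implicit Types (A B : lions_data I F) (P Q : lions_pdata I F).

(** The order of Lions partition forests on a fixed labelled forest. *)
Definition pdata_le P Q : Prop :=
  tp_le (root_part P) (root_part Q) /\
  forall x, tp_le (child_part P x) (child_part Q x).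

Lemma restrict_le A B :
  tp_le (lions_part A) (lions_part B) -> pdata_le (restrict A) (restrict B).
Proof.
move=> /tp_leP[tagAB relAB]; split=> [|x]; apply/tp_leP; split.
- by move=> i; apply: finset.setSI.
- by move=> y z /restrict_roots_rel[ry rz /relAB yz]; apply/restrict_roots_rel.
- move=> u; apply/fintype.subsetP => y; rewrite !in_set.
  by move=> /andP[-> /asboolP/relAB yx]; apply/asboolP.
by move=> y z /restrict_children_rel[yx zx /relAB] ?; apply/restrict_children_rel.
Qed.

(** The tags are compared by induction on the depth, and the relations by
    induction on the sum of the depths of the two related nodes. *)
Lemma restrict_le_inv A B :
  pdata_le (restrict A) (restrict B) -> tp_le (lions_part A) (lions_part B).
Proof.
move=> [/tp_leP[root_tagAB root_relAB] child_leAB].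
have child_relAB x y z : (y, x) \in edges F -> (z, x) \in edges F ->
    tp_rel (lions_part A) y z -> tp_rel (lions_part B) y z.
  move=> yx zx yz; have /tp_leP[_ relAB] := child_leAB x.
  suff /restrict_children_rel[] : tp_rel (restrict_children B x) y z by [].
  exact/relAB/restrict_children_rel.
have parentAB x y : (y, x) \in edges F ->
    tp_rel (lions_part A) y x -> tp_rel (lions_part B) y x.
  move=> yx rel_yx; have /tp_leP[/(_ tt)/fintype.subsetP/(_ y) tagAB _] := child_leAB x.
  move: tagAB; rewrite !in_set yx => tagAB.
  exact/asboolP/tagAB/asboolP.
apply/tp_leP; split=> [i|y z].
  apply/fintype.subsetP => y; have [n] := ubnP (fdepth y).
  elim: n y => // n IHn y lt_yn yi; have [ry|[x yx]] := root_or_child (edges F) y.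
    have /fintype.subsetP/(_ y) := root_tagAB i.
    by rewrite /= !in_setI yi ry => /(_ isT)/andP[].
  have rel_yx := lions_tag_parent yi yx.
  apply: tp_rel_tag (tp_rel_sym (parentAB x y yx rel_yx)).
  apply: IHn (tp_rel_tag yi rel_yx).
  by move: lt_yn; rewrite /fdepth (depth_arc _ yx).
have [n] := ubnP (fdepth y + fdepth z).
elim: n y z => // n IHn y z lt_n rel_yz.
wlog le_yz : y z lt_n rel_yz / fdepth y <= fdepth z.
  move=> W; have [/W|/ltnW/W] := leqP (fdepth y) (fdepth z); first exact.
  by rewrite addnC => WW; apply/tp_rel_sym/WW/tp_rel_sym.
have [rz|[x' zx']] := root_or_child (edges F) z.
  have [ry|[x yx]] := root_or_child (edges F) y.
    suff /restrict_roots_rel[] : tp_rel (restrict_roots B) y z by [].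
    exact/root_relAB/restrict_roots_rel.
  by move: le_yz; rewrite /fdepth (depth_root _ rz) (depth_arc _ yx).
(* If the class of z contains the parent of z, the induction hypothesis
   applies to y and this parent. *)
have step : tp_rel (lions_part A) z x' -> tp_rel (lions_part B) y z.
  move=> rel_zx'; apply: tp_rel_trans (tp_rel_sym (parentAB x' z zx' rel_zx')).
  apply: IHn (tp_rel_trans rel_yz rel_zx').
  by move: lt_n; rewrite /fdepth (depth_arc _ zx') addnS.
have [lt_yz|] := boolP (fdepth y < fdepth z).
  exact/step/(lions_parent_deeper rel_yz).
rewrite -leqNgt => le_zy; have eq_yz : fdepth y = fdepth z.
  by apply/eqP; rewrite eqn_leq le_yz.
have [ry|[x yx]] := root_or_child (edges F) y.
  by move: eq_yz; rewrite /fdepth (depth_root _ ry) (depth_arc _ zx').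
have [def_x|neq_x] := pselect (x = x').
  by apply: (child_relAB x) rel_yz; rewrite // def_x.
by have [_ /step] := lions_parent_level rel_yz eq_yz yx zx' neq_x.
Qed.

Lemma lions_data_eq A B : lions_part A = lions_part B -> A = B.
Proof.
case: A B => [pA A1 A2 A3] [pB B1 B2 B3] /= eqAB; subst pB.
by congr LionsData; apply: Prop_irrelevance.
Qed.

Lemma restrict_inj : injective (@restrict V d I F).
Proof.
move=> A B eqAB; apply/lions_data_eq/tp_le_anti; apply: restrict_le_inv;
  by rewrite eqAB; split=> [|x]; apply: tp_le_refl.
Qed.

End RestrictionOrder.

(** * From Lions partition forests to Lions forests *)

Section Gluing.
Variables (V : choiceType) (d : nat) (I : Type) (F : lforest V d).
Variable (B : lions_pdata I F).
Local Notation E := (edges F).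
Local Notation EF := (edgesP F).
Local Notation r := (root_part B).
Local Notation c := (child_part B).
Implicit Types (x y z : nodes F) (b : {set nodes F}).

(** The parent x of y if y is in the tagged set of the children of x, and y
    itself otherwise. *)
Definition climb y : nodes F :=
  if [pick x | ((y, x) \in E) && (y \in tp_tag (c x) tt)] is Some x then x else y.

(** The top of the chain of tagged nodes starting at y. A node has as many
    ancestors as its depth, so this number of steps always suffices. *)
Definition head y : nodes F := iter (fdepth y) climb y.

Lemma climb_tag y x : (y, x) \in E -> y \in tp_tag (c x) tt -> climb y = x.
Proof.
move=> yx tag_y; rewrite /climb; case: pickP => [z /andP[yz _]|/(_ x)].
  exact: (parent_uniq EF yz yx).
by rewrite yx tag_y.
Qed.

Lemma head_tag y x : (y, x) \in E -> y \in tp_tag (c x) tt -> head y = head x.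
Proof.
move=> yx tag_y.
by rewrite /head /fdepth (depth_arc EF yx) iterSr (climb_tag yx tag_y).
Qed.

(** y is a root, or is not tagged among the children of its parent. *)
Definition is_head y : Prop := forall x, (y, x) \in E -> y \notin tp_tag (c x) tt.

Lemma climb_id y : is_head y -> climb y = y.
Proof.
move=> hy; rewrite /climb; case: pickP => // x /andP[yx tag_y].
by have /negP := hy x yx.
Qed.

Lemma head_id y : is_head y -> head y = y.
Proof. by move=> /climb_id climb_y; apply: iter_fix. Qed.

Lemma head_or_tag y :
  is_head y \/ exists x, [/\ (y, x) \in E, y \in tp_tag (c x) tt & head y = head x].
Proof.
have [[x [yx tag_y]]|ntag] :=
    pselect (exists x, (y, x) \in E /\ y \in tp_tag (c x) tt).
  by right; exists x; split=> //; apply: head_tag.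
by left=> x yx; apply/negP => tag_y; apply: ntag; exists x.
Qed.

Lemma headP y : is_head (head y) /\ fdepth (head y) <= fdepth y.
Proof.
have [n] := ubnP (fdepth y); elim: n y => // n IHn y lt_yn.
have [hy|[x [yx _ ->]]] := head_or_tag y; first by rewrite head_id.
have dy : fdepth y = (fdepth x).+1 by apply: depth_arc.
have [|hx le_x] := IHn x; first by rewrite -ltnS -dy.
by split=> //; rewrite dy (leq_trans le_x).
Qed.

Lemma root_is_head y : y \in roots E -> is_head y.
Proof. by move=> /rootP ry x yx; have /negP := ry x. Qed.

(** The blocks of the partitions of the roots and of all sets of children. *)
Definition all_blocks : {set {set nodes F}} :=
  tp_blocks r :|: \bigcup_x tp_blocks (c x).

Lemma all_blocksP b :
  b \in all_blocks <-> b \in tp_blocks r \/ exists x, b \in tp_blocks (c x).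
Proof.
rewrite in_setU; split=> [/orP[->|/bigcupP[x _ cb]]|[->//|[x cb]]]; first by left.
  by right; exists x.
by apply/orP; right; apply/bigcupP; exists x.
Qed.

Lemma all_blocks_root b y :
  b \in all_blocks -> y \in b -> y \in roots E -> b \in tp_blocks r.
Proof.
case/all_blocksP=> // -[x cb] yb /rootP ry.
by have [] := tp_block_mem cb yb; rewrite in_set (negPf (ry x)).
Qed.

Lemma all_blocks_child b y x :
  b \in all_blocks -> y \in b -> (y, x) \in E -> b \in tp_blocks (c x).
Proof.
case/all_blocksP=> [rb yb yx|[x' cb yb yx]].
  by have [/rootP/(_ x)/negP] := tp_block_mem rb yb.
have [] := tp_block_mem cb yb; rewrite in_set => yx' _.
by rewrite (parent_uniq EF yx yx').
Qed.

Lemma all_blocks_head b y : b \in all_blocks -> y \in b -> is_head y.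
Proof.
by move=> Bb yb x yx; have [] := tp_block_mem (all_blocks_child Bb yb yx) yb.
Qed.

Lemma all_blocks_neq0 b : b \in all_blocks -> exists y, y \in b.
Proof. by case/all_blocksP => [/tp_block_neq0//|[x /tp_block_neq0]]. Qed.

Lemma all_blocks_eq b b' y :
  b \in all_blocks -> b' \in all_blocks -> y \in b -> y \in b' -> b = b'.
Proof.
move=> Bb Bb' yb yb'; have [ry|[x yx]] := root_or_child E y.
  have rb := all_blocks_root Bb yb ry; have rb' := all_blocks_root Bb' yb' ry.
  by apply: (tp_class_eq _ _ yb yb'); left; [exact: rb | exact: rb'].
have cb := all_blocks_child Bb yb yx; have cb' := all_blocks_child Bb' yb' yx.
by apply: (tp_class_eq _ _ yb yb'); left; [exact: cb | exact: cb'].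
Qed.

Lemma all_blocks_level b y z :
  b \in all_blocks -> y \in b -> z \in b -> fdepth y = fdepth z.
Proof.
case/all_blocksP => [rb|[x cb]].
  move=> /(tp_block_mem rb)[ry _] /(tp_block_mem rb)[rz _].
  by rewrite /fdepth !depth_root.
move=> /(tp_block_mem cb)[+ _] /(tp_block_mem cb)[+ _].
by rewrite !in_set /fdepth => /(depth_arc EF)-> /(depth_arc EF)->.
Qed.

Lemma head_all_blocks y : (forall i, head y \notin tp_tag r i) ->
  exists2 b, b \in all_blocks & head y \in b.
Proof.
move=> ntag; have [ry|[x yx]] := root_or_child E (head y).
  have [b [rb|[i ->]] yb] := tp_class_ex r ry; last by have /negP := ntag i.
  by exists b => //; apply/all_blocksP; left.
have [|b [cb|[[] ->]] yb] := @tp_class_ex _ _ _ (c x) (head y).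
- by rewrite in_set.
- by exists b => //; apply/all_blocksP; right; exists x.
by have [/(_ x yx)/negP] := headP y.
Qed.

Definition glue_tag i := head @^-1: tp_tag r i.

Definition glue_blocks := [set head @^-1: b | b : {set nodes F} in all_blocks].

Lemma glue_tag_sub i : glue_tag i \subset [set: nodes F].
Proof. exact: finset.subsetT. Qed.

Lemma glue_tag_disjoint i j : i <> j -> [disjoint glue_tag i & glue_tag j].
Proof.
move=> neq_ij; apply/pred0P => y /=; apply/negP => /andP[].
by rewrite !in_set => yi yj; apply: neq_ij; apply: tp_tag_inj yi yj.
Qed.

Lemma glue_partition :
  partition glue_blocks
            ([set: nodes F] :\: [set y | `[< exists i, y \in glue_tag i >]]).
Proof.
apply: partition_intro.
- apply/imsetP => -[b Bb /setP def_b]; have [y yb] := all_blocks_neq0 Bb.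
  by have := def_b y; rewrite !in_set head_id ?yb //; apply: all_blocks_head yb.
- move=> _ _ y /imsetP[b Bb ->] /imsetP[b' Bb' ->]; rewrite !in_set => yb yb'.
  by rewrite (all_blocks_eq Bb Bb' yb yb').
move=> y; rewrite !in_set andbT; split=> [/asboolP ntag|[_ /imsetP[b Bb ->]]].
  have [i|b Bb yb] := @head_all_blocks y.
    by apply/negP => yi; apply: ntag; exists i; rewrite in_set.
  by exists (head @^-1: b); rewrite ?in_set //; apply: imset_f.
rewrite in_set => yb; apply/asboolP => -[i]; rewrite in_set => yi.
have ry := fintype.subsetP (tp_tag_sub r i) _ yi.
by have [_ /(_ i)/negP] := tp_block_mem (all_blocks_root Bb yb ry) yb.
Qed.

(** The tagged partition of all nodes formed by the preimages under [head] of
    the tagged sets of roots and of all blocks. *)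
Definition glue_part : tpartition I [set: nodes F] :=
  TPartition glue_tag_sub glue_tag_disjoint glue_partition.

Lemma glue_relP y z :
  tp_rel glue_part y z <->
    (exists i, head y \in tp_tag r i /\ head z \in tp_tag r i) \/
    (exists2 b, b \in all_blocks & head y \in b /\ head z \in b).
Proof.
split=> [[h [[/imsetP[b Bb ->]|[i ->]]]]|[[i [yi zi]]|[b Bb [yb zb]]]].
- by rewrite !in_set => yb zb; right; exists b.
- by rewrite !in_set => yi zi; left; exists i.
- by exists (glue_tag i); rewrite !in_set; split=> //; right; exists i.
exists (head @^-1: b); rewrite !in_set; split=> //; left.
exact: imset_f.
Qed.

Lemma glue_rel_head y : tp_rel glue_part y (head y).
Proof.
apply/glue_relP; rewrite (head_id (proj1 (headP y))).
have [[i yi]|ntag] := pselect (exists i, head y \in tp_tag r i).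
  by left; exists i.
have [i|b Bb yb] := @head_all_blocks y; last by right; exists b.
by apply/negP => yi; apply: ntag; exists i.
Qed.

Lemma glue_rel_eq y z : head y = head z -> tp_rel glue_part y z.
Proof.
by move=> eq_yz; apply: tp_rel_trans (glue_rel_head y) _;
  rewrite eq_yz; apply: tp_rel_sym (glue_rel_head z).
Qed.

Lemma glue_rel_level y z :
  tp_rel glue_part y z -> fdepth (head y) = fdepth (head z).
Proof.
case/glue_relP => [[i [yi zi]]|[b Bb [yb zb]]]; last exact: all_blocks_level Bb _ _.
have tag_root := fintype.subsetP (tp_tag_sub r i).
by rewrite /fdepth !depth_root ?tag_root.
Qed.

(** A node strictly below its head is related to its parent. *)
Lemma glue_rel_parent y z z' :
    tp_rel glue_part y z -> (z, z') \in E -> fdepth (head z) < fdepth z ->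
  tp_rel glue_part y z'.
Proof.
move=> yz zz' lt_z; suff eq_zz' : head z = head z'.
  by apply: tp_rel_trans yz _; apply: glue_rel_eq.
have [/head_id eq_z|[x [zx _ ->]]] := head_or_tag z.
  by rewrite eq_z ltnn in lt_z.
by rewrite (parent_uniq EF zx zz').
Qed.

Lemma glue_class_rel h y z :
  lions_class glue_part h -> y \in h -> z \in h -> tp_rel glue_part y z.
Proof. by move=> [ph _] hy hz; exists h. Qed.

Lemma glue_class_mem h y z :
  lions_class glue_part h -> y \in h -> tp_rel glue_part y z -> z \in h.
Proof. by move=> [ph _]; apply: tp_rel_mem. Qed.

Lemma glue_cond1 : lions_cond1 glue_part.
Proof.
move=> h x y lh hx hy lt_xy; have xy := glue_class_rel lh hx hy.
have [ry|[z yz]] := root_or_child E y; first by rewrite {2}/fdepth depth_root in lt_xy.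
exists z => //; apply: glue_class_mem lh hx _.
apply: (glue_rel_parent xy yz).
by rewrite -(glue_rel_level xy) (leq_ltn_trans _ lt_xy) //; case: (headP x).
Qed.

Lemma glue_cond2 : lions_cond2 glue_part.
Proof.
move=> h x1 y1 x2 y2 lh hx hy eq_xy xx yy neq_xy.
have rel_xy := glue_class_rel lh hx hy.
have [_ le_x] := headP x1; have [_ le_y] := headP y1.
(* The heads of x1 and y1 are at the same depth, as x1 and y1 are, so x1 and
   y1 are either both strictly below their heads or both their own heads. In
   the second case they lie in one block of children, against x2 <> y2. *)
have [lt_x|le_x'] := ltnP (fdepth (head x1)) (fdepth x1).
  split; apply: glue_class_mem lh hx _.
    exact: (glue_rel_parent (glue_rel_eq (erefl (head x1)))).
  apply: (glue_rel_parent rel_xy yy).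
  by rewrite -(glue_rel_level rel_xy) -eq_xy.
have lvl := glue_rel_level rel_xy.
have hd z z' : (z, z') \in E -> fdepth z <= fdepth (head z) -> head z = z.
  move=> zz' le_z; have [/head_id //|[x [zx _ eq_x]]] := head_or_tag z.
  have [_ le_hx] := headP x.
  move: le_z; rewrite eq_x leqNgt (leq_ltn_trans le_hx) //.
  by rewrite /fdepth (depth_arc EF zx).
have {}hdx := hd _ _ xx le_x'.
have {hd}hdy : head y1 = y1 by apply: hd yy _; rewrite -lvl -eq_xy.
case/glue_relP: rel_xy => [[i []]|[b Bb []]]; rewrite hdx hdy.
  by move=> /(fintype.subsetP (tp_tag_sub r i))/rootP/(_ x2)/negP[].
move=> xb yb; have cb := all_blocks_child Bb xb xx.
have [] := tp_block_mem cb yb; rewrite in_set => yx2 _.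
by case: neq_xy; apply: (parent_uniq EF yx2 yy).
Qed.

Lemma glue_cond3 : lions_cond3 glue_part.
Proof.
move=> i /set0Pn[y]; rewrite in_set => yi.
have ry := fintype.subsetP (tp_tag_sub r i) _ yi.
by exists (head y) => //; rewrite in_set head_id //; apply: root_is_head.
Qed.

(** The Lions forest associated with a Lions partition forest. *)
Definition glue : lions_data I F := LionsData glue_cond1 glue_cond2 glue_cond3.

(** An untagged child is its own head, hence strictly deeper than the head of
    its parent, whereas related nodes have heads at the same depth. *)
Lemma glue_rel_parent_tag y x :
  (y, x) \in E -> tp_rel glue_part y x <-> y \in tp_tag (c x) tt.
Proof.
move=> yx; split=> [rel_yx|tag_y]; last exact/glue_rel_eq/head_tag.
have lvl := glue_rel_level rel_yx; have [_ le_x] := headP x.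
have [/head_id eq_y|[x' [yx' tag_y _]]] := head_or_tag y.
  move: le_x; rewrite -lvl eq_y /fdepth (depth_arc EF yx); by rewrite ltnn.
by rewrite (parent_uniq EF yx yx').
Qed.

Lemma glue_restrict_roots : restrict_roots glue = r.
Proof.
apply: tp_eq => [i y|y z].
  rewrite in_setI in_set; split=> [/andP[yi ry]|yi].
    by rewrite head_id // in yi; apply: root_is_head.
  have ry := fintype.subsetP (tp_tag_sub r i) _ yi.
  by rewrite head_id ?yi //; apply: root_is_head.
split=> [/restrict_roots_rel[/[dup] ry /root_is_head/head_id hy
                             /root_is_head/head_id hz]|yz].
  case/glue_relP => [[i []]|[b Bb []]]; rewrite hy hz => mem_y mem_z.
    by exists (tp_tag r i); split=> //; right; exists i.
  by exists b; split=> //; left; apply: all_blocks_root mem_y ry.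
have [ry rz] := tp_rel_dom yz; apply/restrict_roots_rel; split=> //.
apply/glue_relP; rewrite !head_id; try exact: root_is_head.
case: yz => b [[rb|[i ->]] yb zb]; last by left; exists i.
by right; exists b => //; apply/all_blocksP; left.
Qed.

Lemma glue_restrict_children x : restrict_children glue x = c x.
Proof.
apply: tp_eq => [[] y|y z].
  rewrite in_set; split=> [/andP[cy /asboolP rel_yx]|tag_y].
    by rewrite in_set in cy; apply/(glue_rel_parent_tag cy).
  have yx := fintype.subsetP (tp_tag_sub (c x) tt) _ tag_y.
  rewrite yx; rewrite in_set in yx.
  exact/asboolP/(glue_rel_parent_tag yx).
have rel_tag u v : (u, x) \in E -> u \in tp_tag (c x) tt ->
    (v, x) \in E -> tp_rel glue_part u v -> v \in tp_tag (c x) tt.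
  move=> ux tag_u vx uv; apply/(glue_rel_parent_tag vx).
  exact: tp_rel_trans (tp_rel_sym uv) (proj2 (glue_rel_parent_tag ux) tag_u).
have not_tag u : (u, x) \in E -> u \notin tp_tag (c x) tt -> is_head u.
  by move=> ux ntag x' ux'; rewrite -(parent_uniq EF ux ux').
split=> [/restrict_children_rel[yx zx yz]|yz].
  have [tag_y|ntag_y] := boolP (y \in tp_tag (c x) tt).
    exists (tp_tag (c x) tt); split=> //; first by right; exists tt.
    exact: rel_tag yz.
  have ntag_z : z \notin tp_tag (c x) tt.
    apply: contra ntag_y => tag_z; apply: rel_tag zx tag_z yx _.
    exact: tp_rel_sym.
  have hy := head_id (not_tag y yx ntag_y); have hz := head_id (not_tag z zx ntag_z).
  case/glue_relP: yz => [[i []]|[b Bb []]]; rewrite hy hz => mem_y mem_z.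
    by have /rootP/(_ x)/negP := fintype.subsetP (tp_tag_sub r i) _ mem_y.
  by exists b; split=> //; left; apply: all_blocks_child mem_y yx.
have [yx zx] := tp_rel_dom yz; rewrite !in_set in yx zx.
apply/restrict_children_rel; split=> //.
case: yz => b [[cb|[[] ->]] yb zb]; last first.
  by apply: glue_rel_eq; rewrite (head_tag yx yb) (head_tag zx zb).
have Bb : b \in all_blocks by apply/all_blocksP; right; exists x.
apply/glue_relP; right; exists b => //.
by rewrite !head_id //; apply: all_blocks_head Bb _.
Qed.

Lemma glueK : restrict glue = B.
Proof.
rewrite /restrict; case: B glue_restrict_roots glue_restrict_children => /= rB cB -> eq_c.
by congr LionsPData; apply: functional_extensionality_dep.
Qed.

End Gluing.

(** * The isomorphism *)

Section OrderInversion.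
Variables (V : choiceType) (d : nat) (I : Type).

(** The two forests of comparable Lions partition forests are equal, and the
    data are comparable after transport along this equality. *)
Lemma lpf_le_inv (P Q : lions_pforest V d I) : lpf_le P Q ->
  exists e : lpf_forest P = lpf_forest Q,
    pdata_le (eq_rect _ (lions_pdata I) (lpf_data P) _ e) (lpf_data Q).
Proof. by case=> F A B le_root le_child; exists erefl. Qed.

End OrderInversion.

Theorem theorem4p9 (V : choiceType) (Vinf : infinite_set [set: V]%classic)
    (d : nat) (I : Type) :
  exists f : lions_forest V d I -> lions_pforest V d I,
    [/\ bijective f,
        (forall A B : lions_forest V d I, lf_le A B <-> lpf_le (f A) (f B)) &
        (forall A : lions_forest V d I, lpf_m (f A) = lf_m A)].
Proof.
exists (fun A => LionsPForest (restrict (lf_data A))); split.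
- exists (fun P => LionsForest (glue (lpf_data P))) => [[F A]|[F P]] /=.
    by congr LionsForest; apply: restrict_inj; rewrite glueK.
  by rewrite glueK.
- move=> A B; split=> [[F A' B' /restrict_le[le_root le_child]]|]; first by constructor.
  case: A B => [F A] [G B] /lpf_le_inv[/= e].
  by case: _ / e B => B le_AB; constructor; apply: restrict_le_inv.
by move=> [F A]; apply: restrict_card.
Qed.
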